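(* Let $n\in\mathbb{N}$ with $n\geq 3$ and $n\neq 8$, let $g\in\mathbb{C}$ satisfy $g^4=8-n$, and let $\varepsilon\in\{1,-1\}$. Set $$a_1=8(g^4-1)\bigl(g^2+2\sqrt2\,\varepsilon\bigr)^4,\quad a_2=2g^2+2\sqrt2\,\varepsilon,\quad a_3=-2\sqrt2\,\varepsilon g^4-8g^2,\quad a_4=2g,\quad a_5=-2\sqrt2\,\varepsilon g^3-8g.$$ Then the form $q_n=x_1^2+\cdots+x_n^2$ satisfies $$3a_5^4\,q_n^2=a_1\Bigl(\sum_{j=1}^n x_j\Bigr)^4+\sum_{k=1}^n\Bigl(a_2\sum_{j=1}^n x_j+a_3x_k\Bigr)^4+\sum_{1\le j_1<j_2\le n}\Bigl(a_4\sum_{j=1}^n x_j+a_5(x_{j_1}+x_{j_2})\Bigr)^4$$ in $\mathbb{C}[x_1,\dots,x_n]$. *)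

(* Defs.v *)
(* MathComp; the base ring K is meant to be R[i] for a realType R, the complex
   numbers. *)
From mathcomp Require Export all_boot all_order all_algebra.
From mathcomp Require Export reals complex mpoly.

Set Implicit Arguments.
Unset Strict Implicit.
Unset Printing Implicit Defensive.

Import GRing.Theory Num.Theory.
Local Open Scope ring_scope.

Definition qform (K : comNzRingType) (n : nat) : {mpoly K[n]} :=
  \sum_(j < n) 'X_j ^+ 2.

Definition sumX (K : comNzRingType) (n : nat) : {mpoly K[n]} :=
  \sum_(j < n) 'X_j.

Arguments qform K n : clear implicits.
Arguments sumX K n : clear implicits.

(* Main.v *)
Require Import Defs.
From mathcomp Require Import all_boot all_order all_algebra.
From mathcomp Require Import reals complex mpoly.
From mathcomp Require Import ring.

Import GRing.Theory Num.Theory.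
Local Open Scope ring_scope.
Local Open Scope complex_scope.

(** Both sides are symmetric quartic forms, so they can be compared on the
    products of power sums p1^4, p1^2 p2, p1 p3, p2^2, p4, where p_k is the sum
    of the k-th powers of the variables. Put t = sqrt 2 * eps, so that t^2 = 2.
    Twice the sum over the pairs j1 < j2 is the sum over all ordered pairs
    minus the diagonal ([sum_sym_pairs]). The full sums expand by the binomial
    theorem ([sum_exp_affine], [sum_exp_affine_pairs]), where n enters as p_0.

    The coefficients are tuned so that everything but p2^2 cancels. Note that
    a3 = g a5 and a5 = - 2 g (t g^2 + 4). On the right-hand side:
    - p2^2 gets 3 a5^4, from the pairs only;
    - p4 gets a3^4 + (n - 8) a5^4 = a5^4 (g^4 + n - 8) = 0, which is where
      g^4 = 8 - n comes from;
    - p1 p3 gets 4 a5^3 (a2 g^3 + (n - 4) a4 + a5) = 0;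
    - p1^2 p2 gets 6 a5^2 (a2^2 g^2 + (n - 2) a4^2 + 2 a4 a5), which vanishes
      thanks to t^2 = 2;
    - p1^4 gets a1 plus a polynomial in g and t, and a1 is the opposite of that
      polynomial.

    The cancellation rests on the two relations on t and g and on the
    regularity of 2, so it is carried out over any commutative ring in which 2
    is regular ([quartic_power_sum_identity]); the theorem is the instance of
    the polynomial ring, with the scalars viewed as constant polynomials. *)

Definition power_sum {A : comNzRingType} {n : nat} (x : 'I_n -> A)
    (k : nat) : A :=
  \sum_(i < n) x i ^+ k.

Lemma sum_exp_affine (A : comNzRingType) (n m : nat) (x : 'I_n -> A)
    (y d : A) :
  \sum_(j < n) (y + d * x j) ^+ m =
  \sum_(k < m.+1) y ^+ (m - k) * (d ^+ k * power_sum x k) *+ 'C(m, k).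
Proof.
under eq_bigr do rewrite exprDn.
rewrite exchange_big /=; apply: eq_bigr => k _.
rewrite sumrMnl /power_sum !mulr_sumr; congr (_ *+ _); apply: eq_bigr => j _.
by rewrite exprMn.
Qed.

(** Applies [sum_exp_affine] twice: first to the sum over [j], with
    [y + d * x i] as constant term, then to the sums of the powers of these
    constant terms over [i]. *)
Lemma sum_exp_affine_pairs (A : comNzRingType) (n m : nat) (x : 'I_n -> A)
    (y d : A) :
  \sum_(i < n) \sum_(j < n) (y + d * (x i + x j)) ^+ m =
  \sum_(k < m.+1)
     (\sum_(l < (m - k).+1)
        y ^+ (m - k - l) * (d ^+ l * power_sum x l) *+ 'C(m - k, l))
     * (d ^+ k * power_sum x k) *+ 'C(m, k).
Proof.
under eq_bigr => i _.
  under eq_bigr do rewrite mulrDr addrA.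
  rewrite sum_exp_affine.
  over.
rewrite exchange_big /=; apply: eq_bigr => k _.
by rewrite sumrMnl -mulr_suml sum_exp_affine.
Qed.

Lemma sum_sym_pairs (V : nmodType) (n : nat) (F : 'I_n -> 'I_n -> V) :
  (forall i j, F i j = F j i) ->
  \sum_(i < n) \sum_(j < n) F i j =
  (\sum_(i < n) \sum_(j < n | (i < j)%N) F i j) *+ 2 + \sum_(i < n) F i i.
Proof.
move=> symF.
have lower : \sum_(i < n) \sum_(j < n | (j < i)%N) F i j =
             \sum_(i < n) \sum_(j < n | (i < j)%N) F i j.
  rewrite [RHS](exchange_big_dep xpredT) //=.
  by apply: eq_bigr => i _; apply: eq_bigr => j _; rewrite symF.
rewrite mulr2n -{2}lower -!big_split /=; apply: eq_bigr => i _.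
rewrite (bigID (fun j : 'I_n => (i < j)%N)) /= -addrA; congr (_ + _).
rewrite (bigD1 i) ?ltnn //= addrC; congr (_ + _).
by apply: eq_bigl => j; rewrite -leqNgt [RHS]ltn_neqAle andbC.
Qed.

(** The number of variables occurs only as the power sum of exponent 0, which
    is [8 - g ^+ 4]; after the expansions the claim is a polynomial identity in
    [g], [t] and the power sums, modulo [t ^+ 2 = 2]. It is proved doubled,
    because the sum over pairs is only known through [sum_sym_pairs]. *)
Lemma quartic_power_sum_identity (A : comNzRingType) (n : nat) (x : 'I_n -> A)
    (g t : A) :
  GRing.lreg (2 : A) -> t ^+ 2 = 2 -> g ^+ 4 = 8 - n%:R ->
  let a1 := 8 * (g ^+ 4 - 1) * (g ^+ 2 + 2 * t) ^+ 4 in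
  let a2 := 2 * g ^+ 2 + 2 * t in
  let a3 := - 2 * t * g ^+ 4 - 8 * g ^+ 2 in
  let a4 := 2 * g in
  let a5 := - 2 * t * g ^+ 3 - 8 * g in
  let s := \sum_(i < n) x i in
  3 * a5 ^+ 4 * (\sum_(i < n) x i ^+ 2) ^+ 2 =
    a1 * s ^+ 4 + \sum_(k < n) (a2 * s + a3 * x k) ^+ 4
    + \sum_(i < n) \sum_(j < n | (i < j)%N) (a4 * s + a5 * (x i + x j)) ^+ 4.
Proof.
move=> reg2 t2 g4 a1 a2 a3 a4 a5 s; apply: reg2.
have sumE : power_sum x 1 = s by [].
have countE : power_sum x 0 = 8 - g ^+ 4.
  rewrite g4 subKr /power_sum.
  by under eq_bigr do rewrite expr0; rewrite sumr_const card_ord.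
(* On the diagonal the summand is again affine in x i, with slope 2 * a5. *)
have := @sum_sym_pairs A n (fun i j => (a4 * s + a5 * (x i + x j)) ^+ 4) _.
move=> /(_ (fun i j => congr1 (fun z => (a4 * s + a5 * z) ^+ 4) (addrC _ _))).
have -> : \sum_(i < n) (a4 * s + a5 * (x i + x i)) ^+ 4 =
          \sum_(i < n) (a4 * s + (2 * a5) * x i) ^+ 4.
  by apply: eq_bigr => i _; ring.
rewrite sum_exp_affine_pairs sum_exp_affine.
rewrite [2 * (_ + _)]mulrDr.
rewrite [2 * (\sum_(i < n) \sum_(j < n | _) _)]mulrC mulr_natr.
move=> /esym /(canRL (addrK _)) ->.
rewrite sum_exp_affine -/(power_sum x 2).
rewrite !big_ord_recr !big_ord0 /= sumE countE.
have [bin42 bin43 bin32] : [/\ 'C(4, 2) = 6, 'C(4, 3) = 4 & 'C(3, 2) = 3]%N by [].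
rewrite !subSS !subn0 !bin0 !bin1 !binn bin42 bin43 bin32.
rewrite {}/a1 {}/a2 {}/a3 {}/a4 {}/a5.
ring: t2.
Qed.

Theorem theorem5p9 (R : realType) (n : nat) (g eps : R[i])
  (hn : (3 <= n)%N) (hn8 : n <> 8%N)
  (hg : g ^+ 4 = 8 - n%:R) (heps : eps = 1 \/ eps = -1) :
  let a1 := 8 * (g ^+ 4 - 1) * (g ^+ 2 + 2 * sqrtC 2 * eps) ^+ 4 in
  let a2 := 2 * g ^+ 2 + 2 * sqrtC 2 * eps in
  let a3 := - 2 * sqrtC 2 * eps * g ^+ 4 - 8 * g ^+ 2 in
  let a4 := 2 * g in
  let a5 := - 2 * sqrtC 2 * eps * g ^+ 3 - 8 * g in
  (3 * a5 ^+ 4) *: qform R[i] n ^+ 2 =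
    a1 *: sumX R[i] n ^+ 4
    + \sum_(k < n) (a2 *: sumX R[i] n + a3 *: 'X_k) ^+ 4
    + \sum_(j1 < n) \sum_(j2 < n | (j1 < j2)%N)
        (a4 *: sumX R[i] n + a5 *: ('X_j1 + 'X_j2)) ^+ 4
  :> {mpoly R[i][n]}.
Proof.
move=> a1 a2 a3 a4 a5; pose t : R[i] := sqrtC 2 * eps.
have t2 : t ^+ 2 = 2.
  by rewrite exprMn sqrtCK; case: heps => ->; rewrite ?sqrrN expr1n mulr1.
have reg2 : GRing.lreg (2 : {mpoly R[i][n]}).
  apply/lregP; rewrite -(rmorph_nat (@mpolyC n R[i])) mpolyC_eq0.
  by rewrite pnatr_eq0.
have t2C : t%:MP_[n] ^+ 2 = 2 by rewrite -rmorphXn /= t2 rmorph_nat.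
have g4C : g%:MP_[n] ^+ 4 = 8 - n%:R.
  by rewrite -rmorphXn /= hg rmorphB /= !rmorph_nat.
have key :=
  @quartic_power_sum_identity {mpoly R[i][n]} n (fun i => 'X_i) _ _
    reg2 t2C g4C.
rewrite -!mul_mpolyC /qform /sumX.
under [X in _ + X + _]eq_bigr do rewrite -!mul_mpolyC.
under [X in _ + X]eq_bigr do under eq_bigr do rewrite -!mul_mpolyC.
have a1C : a1%:MP_[n] =
    8 * (g%:MP_[n] ^+ 4 - 1) * (g%:MP_[n] ^+ 2 + 2 * t%:MP_[n]) ^+ 4.
  by rewrite /a1 /t; ring.
have a2C : a2%:MP_[n] = 2 * g%:MP_[n] ^+ 2 + 2 * t%:MP_[n].
  by rewrite /a2 /t; ring.
have a3C : a3%:MP_[n] = - 2 * t%:MP_[n] * g%:MP_[n] ^+ 4 - 8 * g%:MP_[n] ^+ 2.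
  by rewrite /a3 /t; ring.
have a4C : a4%:MP_[n] = 2 * g%:MP_[n].
  by rewrite /a4; ring.
have a5C : a5%:MP_[n] = - 2 * t%:MP_[n] * g%:MP_[n] ^+ 3 - 8 * g%:MP_[n].
  by rewrite /a5 /t; ring.
have -> : (3 * a5 ^+ 4)%:MP_[n] = 3 * a5%:MP_[n] ^+ 4 by ring.
by rewrite a1C a2C a3C a4C a5C; exact: key.
Qed.
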